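(* Let $f=\frac1n\sum_{i=1}^n f_i:\mathbb{R}^d\to\mathbb{R}$ be $\mu$-strongly convex with $\mu>0$ and $L_f$-smooth, with minimizer $x^*$, and let each $f_i:\mathbb{R}^d\to\mathbb{R}$ be convex and $L$-smooth. Let $\mathcal{P}$ be a proper uniform distribution over subsets of $\{1,\dots,n\}$ with expected minibatch size $\tau$, and let $\mathcal{A},\mathcal{B}\ge 0$ be constants such that $\mathbb{E}_{S\sim\mathcal{P}}\big[\|\sum_{i\in S}\frac{a_i}{p_i}\|^2\big]\le \mathcal{A}\sum_{i=1}^n\|a_i\|^2+\mathcal{B}\|\sum_{i=1}^n a_i\|^2$ for all $a_1,\dots,a_n\in\mathbb{R}^d$. Let $\mathcal{L}=\mathcal{B}L_f+\frac{6\mathcal{A}L}{n}$ and run Minibatch MISO with stepsize $\gamma=\frac{n}{\tau\mathcal{L}}$. Then for all $k\ge 0$, $$\mathbb{E}[\|x^k-x^*\|^2]\le\left(1-\min\left\{\frac{\tau}{2n},\frac{\mu}{2\mathcal{L}},\frac{\mu n^2}{8\mathcal{A}\tau\mathcal{L}}\right\}\right)^k\left(\|x^0-x^*\|^2+\frac{4\mathcal{A}\tau}{n^3}\mathcal{W}^0\right),$$ where $\mathcal{W}^0=\sum_{i=1}^n\|\phi_i^0-x^*-\gamma f_i'(\phi_i^0)+\gamma f_i'(x^* )\|^2$ (if $\mathcal{A}=0$, the third term in the minimum is read as $+\infty$).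
   Context: A differentiable function is $L$-smooth if its gradient is Lipschitz with constant $L\ge 0$; $f'$ and $f_i'$ denote gradients. $\|\cdot\|$ is the Euclidean norm. Sampling: for a distribution $\mathcal{P}$ over the $2^n$ subsets of $\{1,\dots,n\}$ and $S\sim\mathcal{P}$, put $p_i=\mathbb{P}(i\in S)$. $\mathcal{P}$ is proper if $p_i>0$ for all $i$, and uniform if $p_i=p_j$ for all $i,j$. The expected minibatch size is $\tau=\mathbb{E}[|S|]$. Minibatch MISO with stepsize $\gamma>0$: given arbitrary deterministic $\phi_1^0,\dots,\phi_n^0\in\mathbb{R}^d$, set $x^0=\frac1n\sum_{i=1}^n\phi_i^0-\frac{\gamma}{n}\sum_{i=1}^n f_i'(\phi_i^0)$. For $k=0,1,\dots$: draw $S^k\sim\mathcal{P}$ independently of the past; set $\phi_i^{k+1}=x^k$ if $i\in S^k$ and $\phi_i^{k+1}=\phi_i^k$ if $i\notin S^k$; set $x^{k+1}=\frac1n\sum_{i=1}^n\phi_i^{k+1}-\frac{\gamma}{n}\sum_{i=1}^n f_i'(\phi_i^{k+1})$. *)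

(* Defs.v *)
From HB Require Import structures.
From mathcomp Require Export all_boot all_order all_algebra.
From mathcomp Require Export all_classical all_reals all_analysis.

Set Implicit Arguments.
Unset Strict Implicit.
Unset Printing Implicit Defensive.

Export Order.TTheory GRing.Theory Num.Theory.
Export numFieldNormedType.Exports.

Local Open Scope classical_set_scope.
Local Open Scope ring_scope.

(* The library norm on 'rV[R]_d is the sup norm, hence an explicit Euclidean
   norm; differentiability does not depend on the choice of norm. *)
Definition enorm (R : realType) (d : nat) (u : 'rV[R]_d) : R :=
  Num.sqrt (\sum_(j < d) u 0 j ^+ 2).

(* Junk value where f is not differentiable; only used together with
   differentiability. *)
Definition gradient (R : realType) (d : nat) (f : 'rV[R]_d -> R)
    (x : 'rV[R]_d) : 'rV[R]_d :=
  \row_(j < d) 'D_(delta_mx 0 j) (f : 'rV[R]_d -> R^o) x.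

Definition smooth (R : realType) (d : nat) (L : R) (f : 'rV[R]_d -> R) : Prop :=
  [/\ 0 <= L,
      forall x, differentiable (f : 'rV[R]_d -> R^o) x
    & forall x y, enorm (gradient f x - gradient f y) <= L * enorm (x - y)].

Definition strongly_convex (R : realType) (d : nat) (mu : R)
    (f : 'rV[R]_d -> R) : Prop :=
  forall (x y : 'rV[R]_d) (t : R), 0 <= t <= 1 ->
    f (t *: x + (1 - t) *: y) <=
      t * f x + (1 - t) * f y - mu / 2 * (t * (1 - t)) * enorm (x - y) ^+ 2.

Definition average (R : realType) (d n : nat) (f : 'I_n -> 'rV[R]_d -> R)
    (x : 'rV[R]_d) : R :=
  n%:R^-1 * \sum_(i < n) f i x.

(* A distribution over subsets of 'I_n is given by its mass function. *)
Section Sampling.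
Context (R : realType) (n : nat).
Implicit Type P : {set 'I_n} -> R.

Definition is_distribution P : Prop :=
  (forall A, 0 <= P A) /\ \sum_(A : {set 'I_n}) P A = 1.

Definition incl_prob P (i : 'I_n) : R := \sum_(A : {set 'I_n} | i \in A) P A.

Definition proper_sampling P : Prop := forall i, 0 < incl_prob P i.

Definition uniform_sampling P : Prop := forall i j, incl_prob P i = incl_prob P j.

Definition minibatch_size P : R := \sum_(A : {set 'I_n}) P A * #|A|%:R.

Definition AB_inequality (d : nat) P (cA cB : R) : Prop :=
  forall a : 'I_n -> 'rV[R]_d,
    \sum_(A : {set 'I_n})
        P A * enorm (\sum_(i in A) (incl_prob P i)^-1 *: a i) ^+ 2
    <= cA * \sum_(i < n) enorm (a i) ^+ 2 + cB * enorm (\sum_(i < n) a i) ^+ 2.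

(* The random sets S 0, S 1, ... (measurable for the discrete sigma-algebra)
   all have law P, and each S k is independent of the random element
   (S 0, ..., S k.-1); everything before step k is a function of the latter. *)
Definition independent_draws (dO : measure_display) (Omega : measurableType dO)
    (Pr : probability Omega R) P (S : nat -> Omega -> {set 'I_n}) : Prop :=
  [/\ forall k (B : set {set 'I_n}), measurable (S k @^-1` B),
      forall k A, Pr (S k @^-1` [set A]) = (P A)%:E
    & forall k (H : set {ffun 'I_k -> {set 'I_n}}) (B : set {set 'I_n}),
        let past w : {ffun 'I_k -> {set 'I_n}} := [ffun j : 'I_k => S j w] in
        Pr ((past @^-1` H) `&` (S k @^-1` B)) =
        (Pr (past @^-1` H) * Pr (S k @^-1` B))%E].

End Sampling.

Section MinibatchMISO.
Context (R : realType) (d n : nat) (f : 'I_n -> 'rV[R]_d -> R) (gamma : R).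

Definition miso_point (phi : 'I_n -> 'rV[R]_d) : 'rV[R]_d :=
  n%:R^-1 *: \sum_(i < n) phi i
  - (gamma / n%:R) *: \sum_(i < n) gradient (f i) (phi i).

Fixpoint miso_phi (phi0 : 'I_n -> 'rV[R]_d) (s : nat -> {set 'I_n}) (k : nat)
    : 'I_n -> 'rV[R]_d :=
  if k is k'.+1 then
    let phi := miso_phi phi0 s k' in
    fun i => if i \in s k' then miso_point phi else phi i
  else phi0.

Definition miso_x (phi0 : 'I_n -> 'rV[R]_d) (s : nat -> {set 'I_n}) (k : nat)
    : 'rV[R]_d :=
  miso_point (miso_phi phi0 s k).

Definition miso_W0 (phi0 : 'I_n -> 'rV[R]_d) (xstar : 'rV[R]_d) : R :=
  \sum_(i < n) enorm (phi0 i - xstar - gamma *: gradient (f i) (phi0 i)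
                      + gamma *: gradient (f i) xstar) ^+ 2.

End MinibatchMISO.

(* Main.v *)
Require Import Defs.
From mathcomp Require Import ring lra.

Local Open Scope classical_set_scope.
Local Open Scope ring_scope.

(** Write [p = tau / n] for the common inclusion probability and
    [calL = B L_f + 6 A L / n], so that [gamma = 1 / (p calL)] (with [1 / 0 = 0];
    what is used of it is [p gamma^2 calL = gamma]). The method only
    depends on the table [psi_i = phi_i - gamma f_i'(phi_i)]: [x^k] is its mean,
    and a step replaces the drawn entries by [x^k - gamma f_i'(x^k)]. At the
    fixed point, the entries are [xstar - gamma f_i'(xstar)], with mean [xstar].

    The proof is a drift estimate for the potential
    [V = |x^k - xstar|^2 + (4 A p / n^2) W^k], where [W^k] is the sum of the
    squared distances of the table entries to their values at the fixed point.
    With [r = x^k - xstar], averaging over one draw has the following effect.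

    - The mean moves by an unbiased gradient step, with second moment bounded by
      the assumption on [A] and [B] ([mean_replace_sqr]). This gives the descent
      term [- 2 p gamma <f'(x), r>], a term in [B |f'(x)|^2] and a term in [A]
      times the spread of the table.
    - [W] is multiplied by [1 - p], up to the contribution of the refreshed
      entries ([sum_replace]).

    Cocoercivity of the gradients ([smooth_convex_cocoercive],
    [smooth_minimizer_sqr_gradient]) bounds all squared gradients by
    [f(x) - f(xstar)], and the choice of [gamma] makes their total coefficient
    exactly what the descent term compensates. Strong convexity then leaves
    [- (mu / calL) |r|^2]. The coupling between the two parts of [V] is harmless
    because [n |r|^2 <= W]: splitting [W] into [n |r|^2] and the spread of the
    table, each part of [V] contracts separately, the spread at rate [p / 2] and
    [|r|^2] at rate [mu / calL] ([lyapunov_drift], [lyapunov_step]). Both are at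
    least the rate of the theorem.

    It remains to pass from one draw to the whole trajectory. The state before
    step [k] is a function of the first [k] draws, a random variable with
    finitely many values that is independent of the next one, so expectations
    are finite sums and the one-step estimate can be iterated
    ([expectation_run_le]). *)

(** * Euclidean inner product *)

Definition dot {R : realType} {d : nat} (u v : 'rV[R]_d) : R :=
  (u *m v^T) 0 0.

Section InnerProduct.
Context {R : realType} {d : nat}.
Implicit Types (u v w : 'rV[R]_d) (c : R).

Lemma dotE u v : dot u v = \sum_(j < d) u 0 j * v 0 j.
Proof. by rewrite /dot mxE; apply: eq_bigr => j _; rewrite mxE. Qed.

Lemma dotC u v : dot u v = dot v u.
Proof. by rewrite !dotE; apply: eq_bigr => j _; rewrite mulrC. Qed.

Lemma dotDl u v w : dot (u + v) w = dot u w + dot v w.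
Proof. by rewrite /dot mulmxDl mxE. Qed.

Lemma dotNl u w : dot (- u) w = - dot u w.
Proof. by rewrite /dot mulNmx mxE. Qed.

Lemma dotZl c u w : dot (c *: u) w = c * dot u w.
Proof. by rewrite /dot -scalemxAl mxE. Qed.

Lemma dotDr u v w : dot w (u + v) = dot w u + dot w v.
Proof. by rewrite dotC dotDl !(dotC w). Qed.

Lemma dotNr u w : dot w (- u) = - dot w u.
Proof. by rewrite dotC dotNl dotC. Qed.

Lemma dotZr c u w : dot w (c *: u) = c * dot w u.
Proof. by rewrite dotC dotZl dotC. Qed.

Lemma dot0l u : dot 0 u = 0.
Proof. by rewrite /dot mul0mx mxE. Qed.

Lemma dot_suml (I : finType) (Q : pred I) (F : I -> 'rV[R]_d) w :
  dot (\sum_(i | Q i) F i) w = \sum_(i | Q i) dot (F i) w.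
Proof. by rewrite /dot mulmx_suml summxE. Qed.

Definition dot_linE := (dotDl, dotDr, dotNl, dotNr, dotZl, dotZr).

Lemma dot_ge0 u : 0 <= dot u u.
Proof. by rewrite dotE; apply: sumr_ge0 => j _; rewrite -expr2 sqr_ge0. Qed.

Lemma dot_eq0 u : (dot u u == 0) = (u == 0).
Proof.
apply/idP/eqP => [|->]; last by rewrite dot0l.
rewrite dotE psumr_eq0 => [/allP u0|j _]; last by rewrite -expr2 sqr_ge0.
apply/rowP => j; rewrite mxE.
by have := u0 j (mem_index_enum _); rewrite /= mulf_eq0 orbb => /eqP.
Qed.

Lemma enorm_sqr u : enorm u ^+ 2 = dot u u.
Proof.
rewrite /enorm sqr_sqrtr ?dotE; first by apply: eq_bigr => j _; rewrite expr2.
by apply: sumr_ge0 => j _; rewrite sqr_ge0.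
Qed.

(** A square-root-free Cauchy-Schwarz: for [c > 0] it is [0 <= |u - c v|^2]
    divided by [2 c], and for [c = 0] the hypothesis forces [u = 0]. *)
Lemma dot_le_of_sqr_le u v c : 0 <= c ->
  dot u u <= c ^+ 2 * dot v v -> dot u v <= c * dot v v.
Proof.
rewrite le_eqVlt => /predU1P[<-|c_gt0].
  rewrite expr0n /= !mul0r => u0.
  have /eqP : dot u u == 0 by rewrite eq_le u0 dot_ge0.
  by move/eqP; rewrite dot_eq0 => /eqP ->; rewrite dot0l.
move=> uv; have := dot_ge0 (u - c *: v).
rewrite !dot_linE (dotC v u) => h.
rewrite -(ler_pM2l c_gt0).
lra.
Qed.

End InnerProduct.

(** * Gradient inequalities for smooth and strongly convex functions *)

Section GradientInequalities.
Context {R : realType} {d : nat}.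
Implicit Types (f : 'rV[R]_d -> R) (x y v : 'rV[R]_d).

(** Differentiability makes the directional derivative linear in the direction,
    so it is determined by the partial derivatives collected in the gradient. *)
Lemma deriveE_dot_gradient f x v : differentiable (f : _ -> R^o) x ->
  'D_v (f : _ -> R^o) x = dot (gradient f x) v.
Proof.
move=> df; rewrite deriveE // [in LHS](row_sum_delta v) linear_sum dotE.
apply: eq_bigr => j _; rewrite linearZ /= mxE -deriveE //.
by rewrite mulrC.
Qed.

Lemma is_derive_line f x v t : differentiable (f : _ -> R^o) (x + t *: v) ->
  is_derive t (1 : R) ((fun s : R => f (x + s *: v)) : R -> R^o)
    (dot (gradient f (x + t *: v)) v).
Proof.
move=> df.
have e : (fun h : R => h^-1 *: (((fun s : R => f (x + s *: v)) \o shift t) (h *: 1)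
            - f (x + t *: v)) : R^o)
       = (fun h : R => h^-1 *: (((f : _ -> R^o) \o shift (x + t *: v)) (h *: v)
            - f (x + t *: v))).
  apply/funext => h /=; congr (_ *: (f _ - _)).
  by rewrite scalerDl [h *: 1]mulr1 addrA addrAC addrC addrA.
split.
  by rewrite /derivable e; exact: diff_derivable.
by rewrite -deriveE_dot_gradient // /derive e.
Qed.

Lemma smooth_sqr L f x y : smooth L f ->
  dot (gradient f x - gradient f y) (gradient f x - gradient f y)
    <= L ^+ 2 * dot (x - y) (x - y).
Proof.
case=> L0 _ /(_ x y) h; rewrite -!enorm_sqr -exprMn lerXn2r ?nnegrE //.
  exact: sqrtr_ge0.
by rewrite mulr_ge0 // sqrtr_ge0.
Qed.

(** The hypothesis fixes only the length of [y - z], so that the bound serves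
    both orientations of a segment with direction [v]. *)
Lemma smooth_dot_le L f v y z t : smooth L f -> 0 <= t ->
  dot (y - z) (y - z) = t ^+ 2 * dot v v ->
  dot (gradient f y) v <= dot (gradient f z) v + L * t * dot v v.
Proof.
move=> sf t0 yz; have [L0 _ _] := sf.
rewrite -lerBlDl -dotNl -dotDl; apply: dot_le_of_sqr_le; first exact: mulr_ge0.
by rewrite exprMn -mulrA -yz; exact: smooth_sqr.
Qed.

(** The descent lemma. Along the segment, the gap [g] between [f] and its
    quadratic model has nonpositive derivative because the gradient moves by at
    most [L] times the distance travelled; hence [g 1 <= g 0]. *)
Lemma descent_upper L f x v : smooth L f ->
  f (x + v) <= f x + dot (gradient f x) v + L / 2 * dot v v.
Proof.
move=> sf; have [L0 df _] := sf.
pose g (t : R) : R := f (x + t *: v) - t * dot (gradient f x) v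
                      - L / 2 * dot v v * t ^+ 2.
pose g' (t : R) : R := dot (gradient f (x + t *: v)) v - dot (gradient f x) v
                      - L * dot v v * t.
have dg t : is_derive t (1 : R) (g : R -> R^o) (g' t).
  have d1 := is_derive_line f x v t (df _).
  rewrite /g /g'.
  apply: is_derive_eq.
  by rewrite /GRing.scale /=; field.
suff : g 1 <= g 0.
  rewrite /g !scale1r !scale0r addr0; lra.
apply: (@ler0_derive1_le_cc _ g 0 1).
- by move=> s _; have [] := dg s.
- move=> t; rewrite in_itv /= => /andP[t0 _].
  have [_] := dg t; rewrite -derive1E => ->; rewrite /g'.
  have := smooth_dot_le L f v (x + t *: v) x t sf (ltW t0).
  rewrite addrAC subrr add0r dotZl dotZr mulrA -expr2 => /(_ erefl); lra.
- by apply: derivable_within_continuous => t _; have [] := dg t.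
- by rewrite in_itv /= ler01 lexx.
- by rewrite in_itv /= ler01 lexx.
- exact: ler01.
Qed.

(** The limit [t -> 0] in elementary form. *)
Lemma ge0_of_linear_lower_bound (K a : R) :
  (forall t, 0 < t <= 1 -> - (K * t) <= a) -> 0 <= a.
Proof.
move=> h; rewrite leNgt; apply/negP => a_lt0.
have K0 := normr_ge0 K.
have den_gt0 : 0 < 1 + `|K| - a by lra.
(* if a < 0, this t is at most 1 and K t < - a *)
have := h (- a / (1 + `|K| - a)).
rewrite divr_gt0 ?oppr_gt0 // ler_pdivrMr // mul1r lerDr.
rewrite addr_ge0 // => /(_ isT).
rewrite mulrA -mulNr ler_pdivrMr //.
have := ler_norm K; nra.
Qed.

(** Comparing [f (x + t v)] from above by convexity and from below by
    smoothness gives the claim up to an error of order [t]; the lower estimate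
    is the descent lemma started at [x + t v], whose gradient is then moved back
    to [x]. Letting [t] tend to 0 is [ge0_of_linear_lower_bound]. *)
Lemma strongly_convex_first_order mu L f x v :
  strongly_convex mu f -> smooth L f ->
  f x + dot (gradient f x) v + mu / 2 * dot v v <= f (x + v).
Proof.
move=> cf sf; have [L0 _ _] := sf.
rewrite -subr_ge0.
apply: (@ge0_of_linear_lower_bound (3 / 2 * L * dot v v + mu / 2 * dot v v)).
move=> t /andP[t0 t1].
have up : f x <= f (x + t *: v) - t * dot (gradient f (x + t *: v)) v
                 + L / 2 * t ^+ 2 * dot v v.
  have := descent_upper L f (x + t *: v) (- (t *: v)) sf.
  rewrite addrK !dot_linE; lra.
have lip : dot (gradient f x) v <= dot (gradient f (x + t *: v)) v
                                   + L * t * dot v v.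
  apply: smooth_dot_le => //; first exact: ltW.
  by rewrite opprD addrA subrr add0r !dot_linE opprK mulrA expr2.
have := cf (x + v) x t.
rewrite (ltW t0) t1 => /(_ isT).
have -> : t *: (x + v) + (1 - t) *: x = x + t *: v.
  by rewrite scalerDr scalerBl scale1r [X in X + _]addrC addrACA subrr addr0 addrC.
rewrite enorm_sqr [x + v]addrC addrK => cvx.
rewrite -(ler_pM2l t0).
have := ler_wpM2l (ltW t0) lip; lra.
Qed.

(** The best [t] is [1 / L]. When [L = 0] the left-hand side is affine in [t],
    and a slope [- b < 0] would make it negative. *)
Lemma le_of_ge0_quadratic (L a b : R) : 0 <= L -> 0 <= b ->
  (forall t, 0 <= a - t * b + L / 2 * t ^+ 2 * b) -> b <= 2 * L * a.
Proof.
rewrite le_eqVlt => /predU1P[<-|L_gt0] b_ge0 h.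
  rewrite mulr0 mul0r leNgt; apply/negP => b_gt0.
  have := h ((a + 1) / b); rewrite !mul0r divfK ?gt_eqF //; lra.
have := ler_wpM2l (ltW L_gt0) (h L^-1).
have -> : L * (a - L^-1 * b + L / 2 * L^-1 ^+ 2 * b) = L * a - b / 2.
  by field; rewrite gt_eqF.
lra.
Qed.

(** The Bregman divergence of a convex function dominates the squared gradient
    difference: convexity bounds [f (x - t g)] from below by the tangent at [y],
    the descent lemma bounds it from above from [x], and [t] is optimized. *)
Lemma smooth_convex_cocoercive L f x y : strongly_convex 0 f -> smooth L f ->
  dot (gradient f x - gradient f y) (gradient f x - gradient f y)
    <= 2 * L * (f x - f y - dot (gradient f y) (x - y)).
Proof.
move=> cf sf; have [L0 _ _] := sf.
have gE := erefl (gradient f x - gradient f y).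
set g := {2}(gradient f x - gradient f y) in gE.
rewrite !gE; clearbody g.
have key t : 0 <= f x - f y - dot (gradient f y) (x - y) - t * dot g g
                 + L / 2 * t ^+ 2 * dot g g.
  have low := strongly_convex_first_order 0 L f y (x - t *: g - y) cf sf.
  have up := descent_upper L f x (- (t *: g)) sf.
  have e : y + (x - t *: g - y) = x - t *: g by rewrite addrC subrK.
  have gg : dot g g = dot (gradient f x) g - dot (gradient f y) g.
    by rewrite -{1}gE dotDl dotNl.
  move: low up; rewrite e !(dotDr, dotNr, dotZr, dotNl, dotZl) gg; lra.
by apply: le_of_ge0_quadratic => //; exact: dot_ge0.
Qed.

(** A gradient step of length [t] from [x] decreases [f] by the descent lemma,
    but not below its minimum; [t] is then optimized. *)
Lemma smooth_minimizer_sqr_gradient L f xs x : smooth L f ->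
  (forall y, f xs <= f y) ->
  dot (gradient f x) (gradient f x) <= 2 * L * (f x - f xs).
Proof.
move=> sf fmin; have [L0 _ _] := sf.
have key t : 0 <= f x - f xs - t * dot (gradient f x) (gradient f x)
                 + L / 2 * t ^+ 2 * dot (gradient f x) (gradient f x).
  have up := descent_upper L f x (- (t *: gradient f x)) sf.
  have := le_trans (fmin _) up; rewrite !(dotNr, dotZr, dotNl, dotZl); lra.
by apply: le_of_ge0_quadratic => //; exact: dot_ge0.
Qed.

Lemma smooth_minimizer_gradient L f xs : smooth L f ->
  (forall y, f xs <= f y) -> gradient f xs = 0.
Proof.
move=> sf fmin; apply/eqP; rewrite -dot_eq0 eq_le dot_ge0 andbT.
by have := smooth_minimizer_sqr_gradient L f xs xs sf fmin; rewrite subrr mulr0.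
Qed.

Lemma convex_function_strongly_convex0 f :
  convex_function setT f -> strongly_convex 0 f.
Proof.
move=> cf x y t t01.
have := cf (Itv01 (proj1 (andP t01)) (proj2 (andP t01))) x y.
rewrite !inE => /(_ I I).
by rewrite !mul0r subr0.
Qed.

Lemma gradient_average n (F : 'I_n -> 'rV[R]_d -> R) x :
  (forall i, differentiable (F i : _ -> R^o) x) ->
  gradient (average F) x = n%:R^-1 *: \sum_(i < n) gradient (F i) x.
Proof.
move=> dF; apply/rowP => j; rewrite !mxE summxE.
under [in RHS]eq_bigr do rewrite mxE.
have dFj i : derivable (F i : _ -> R^o) x (delta_mx 0 j) by exact: diff_derivable.
have -> : (average F : _ -> R^o)
        = n%:R^-1 \*: (\sum_(i < n) (F i : 'rV[R]_d -> R^o)).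
  by apply/funext => y; rewrite /average /= fct_sumE.
by rewrite deriveZ ?derive_sum //; exact: derivable_sum.
Qed.

End GradientInequalities.

(** * Averages over one draw *)

Section Sampling.
Context {R : realType} {n : nat} (P : {set 'I_n} -> R).

Lemma sum_incl (c : 'I_n -> R) :
  \sum_(A : {set 'I_n}) P A * (\sum_(i in A) c i)
    = \sum_(i < n) incl_prob P i * c i.
Proof.
under eq_bigr do rewrite big_mkcond mulr_sumr.
rewrite exchange_big /=; apply: eq_bigr => i _.
rewrite /incl_prob mulr_suml [RHS]big_mkcond; apply: eq_bigr => A _.
by case: ifP; rewrite ?mulr0.
Qed.

Lemma minibatch_sizeE : minibatch_size P = \sum_(i < n) incl_prob P i.
Proof.
transitivity (\sum_(i < n) incl_prob P i * 1).
  by rewrite -sum_incl; apply: eq_bigr => A _; rewrite sumr_const.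
by apply: eq_bigr => i _; rewrite mulr1.
Qed.

Lemma incl_prob_le1 i : is_distribution P -> incl_prob P i <= 1.
Proof.
move=> [P0 <-]; rewrite [leRHS](bigID (fun A : {set 'I_n} => i \in A)) /= lerDl.
exact: sumr_ge0.
Qed.

Hypothesis P_distr : is_distribution P.

(** Refreshing each entry of a table with probability [incl_prob P i]: only the
    marginal inclusion probabilities matter for additive functionals. *)
Lemma sum_replace (b c : 'I_n -> R) :
  \sum_(A : {set 'I_n}) P A * (\sum_(i < n) if i \in A then b i else c i)
    = \sum_(i < n) ((1 - incl_prob P i) * c i + incl_prob P i * b i).
Proof.
have e (A : {set 'I_n}) : P A * (\sum_(i < n) if i \in A then b i else c i)
    = P A * (\sum_(i < n) c i) + P A * (\sum_(i in A) (b i - c i)).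
  rewrite -mulrDr [X in _ + X]big_mkcond -big_split; congr (_ * _).
  by apply: eq_bigr => i _ /=; case: ifP; rewrite ?addr0 // addrC subrK.
under eq_bigr do rewrite e.
rewrite big_split /= -mulr_suml P_distr.2 mul1r sum_incl -big_split.
by apply: eq_bigr => i _ /=; ring.
Qed.

Context {d : nat} (cA cB p : R).
Hypotheses (p_gt0 : 0 < p) (pE : forall i, incl_prob P i = p).
Hypothesis AB : AB_inequality d P cA cB.

(** The mean of the refreshed table is [r] plus [p / n] times the
    importance-weighted sum of the changes, an unbiased estimator of their full
    sum. The cross term is therefore exact, and the second moment is what
    [AB_inequality] controls. *)
Lemma mean_replace_sqr (u w : 'I_n -> 'rV[R]_d) (r : 'rV[R]_d) :
  r = n%:R^-1 *: \sum_(i < n) w i ->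
  \sum_(A : {set 'I_n}) P A *
      enorm (n%:R^-1 *: \sum_(i < n) (if i \in A then u i else w i)) ^+ 2
  <= enorm r ^+ 2 + 2 * (p / n%:R) * dot (\sum_(i < n) (u i - w i)) r
     + (p / n%:R) ^+ 2 * (cA * \sum_(i < n) enorm (u i - w i) ^+ 2
                          + cB * enorm (\sum_(i < n) (u i - w i)) ^+ 2).
Proof.
move=> rE; pose a i := u i - w i.
pose N (A : {set 'I_n}) := \sum_(i in A) (incl_prob P i)^-1 *: a i.
have mE (A : {set 'I_n}) : n%:R^-1 *: \sum_(i < n) (if i \in A then u i else w i)
    = r + (p / n%:R) *: N A.
  have -> : N A = p^-1 *: \sum_(i in A) a i.
    by rewrite scaler_sumr; apply: eq_bigr => i _; rewrite pE.
  rewrite rE scalerA mulrAC divff ?gt_eqF // mul1r -scalerDr; congr (_ *: _).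
  rewrite [X in _ + X]big_mkcond -big_split; apply: eq_bigr => i _ /=.
  by case: ifP; rewrite ?addr0 // addrC subrK.
under eq_bigr do rewrite mE.
have e (A : {set 'I_n}) : P A * enorm (r + (p / n%:R) *: N A) ^+ 2
   = P A * enorm r ^+ 2 + 2 * (p / n%:R) * (P A * (\sum_(i in A) p^-1 * dot (a i) r))
     + (p / n%:R) ^+ 2 * (P A * enorm (N A) ^+ 2).
  have -> : \sum_(i in A) p^-1 * dot (a i) r = dot (N A) r.
    by rewrite dot_suml; apply: eq_bigr => i _; rewrite dotZl pE.
  by rewrite !enorm_sqr !dot_linE (dotC r (N A)); ring.
under eq_bigr do rewrite e.
rewrite [leLHS]big_split /= [X in X + _ <= _]big_split /=.
rewrite -mulr_suml P_distr.2 mul1r -!mulr_sumr sum_incl.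
have -> : \sum_(i < n) incl_prob P i * (p^-1 * dot (a i) r) = dot (\sum_(i < n) a i) r.
  rewrite dot_suml; apply: eq_bigr => i _.
  by rewrite pE mulrA divff ?mul1r ?gt_eqF.
rewrite lerD2l; apply: ler_wpM2l; [exact: sqr_ge0 | exact: AB].
Qed.

End Sampling.

(** * One step of the method *)

Lemma sum_mean_dev {R : realType} {d n : nat} (w : 'I_n -> 'rV[R]_d) (r : 'rV[R]_d) :
  (0 < n)%N -> r = n%:R^-1 *: \sum_(i < n) w i ->
  \sum_(i < n) dot (w i - r) (w i - r) = \sum_(i < n) dot (w i) (w i) - n%:R * dot r r.
Proof.
move=> n_gt0 rE.
have swr : dot (\sum_(i < n) w i) r = n%:R * dot r r.
  have -> : \sum_(i < n) w i = n%:R *: r.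
    by rewrite rE scalerA divff ?scale1r // pnatr_eq0 -lt0n.
  by rewrite dotZl.
transitivity (\sum_(i < n) (dot (w i) (w i) - 2 * dot (w i) r + dot r r)).
  by apply: eq_bigr => i _; rewrite !dot_linE (dotC r (w i)); ring.
rewrite !big_split /= sumr_const card_ord sumrN -mulr_sumr -dot_suml swr.
by rewrite -[_ *+ n]mulr_natl; ring.
Qed.

(** Young's inequality for [(w - r) + g], the negative of the vector on the
    left. *)
Lemma dot_sub2_le {R : realType} {d : nat} (r g w : 'rV[R]_d) :
  dot (r - g - w) (r - g - w) <= 2 * dot (w - r) (w - r) + 2 * dot g g.
Proof.
have := dot_ge0 (w - r - g).
rewrite !dot_linE (dotC g r) (dotC w r) (dotC w g); lra.
Qed.

Lemma dot_subZ {R : realType} {d : nat} (c : R) (r g : 'rV[R]_d) :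
  dot (r - c *: g) (r - c *: g) = dot r r - 2 * c * dot g r + c ^+ 2 * dot g g.
Proof. by rewrite !dot_linE (dotC r g); ring. Qed.

(** The scalar inequality behind one step. With [x] the current point and
    [r = x - xstar], the symbols stand for
    [rr = |r|^2]; [Y] the mean squared table offset (so [W = n Y]);
    [H] the mean of [|f_i'(x) - f_i'(xstar)|^2]; [Z] the mean squared change of
    a table entry when it is refreshed; [U] the mean squared offset of a
    refreshed entry; [D = f(x) - f(xstar)]; [s = <f'(x), r>]; [F2 = |f'(x)|^2];
    [k = A p / n].

    All terms in [D] produced by [H] and [F2] sum to [2 p gamma D] by the choice
    of [gamma], and they are absorbed by [- 2 p gamma s], leaving
    [- p gamma mu rr]. The remaining terms in [k] are [- 2 k p (Y - rr)] and
    [- 8 k p gamma s]. Since [rr <= Y], the potential splits as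
    [rr + 4 k Y = (1 + 4 k) rr + 4 k (Y - rr)]: the second part contracts by
    [p / 2], and the first by [p gamma mu], as [s >= mu rr] gives
    [8 k p gamma mu rr] on top of [p gamma mu rr]. *)
Lemma lyapunov_drift {R : realFieldType}
    (rr Y H Z U D s F2 k p gamma cB Lf L mu rho : R) :
  0 <= k -> 0 < p -> 0 <= gamma -> 0 <= cB -> 0 <= mu -> 0 <= rr ->
  rr <= Y -> H <= 2 * L * D -> F2 <= 2 * Lf * D ->
  D + mu / 2 * rr <= s -> mu / 2 * rr <= D ->
  Z <= 2 * (Y - rr) + 2 * gamma ^+ 2 * H ->
  U = rr - 2 * gamma * s + gamma ^+ 2 * H ->
  gamma ^+ 2 * (p * cB * Lf + 6 * k * L) = gamma ->
  rho <= p * gamma * mu -> rho <= p / 2 ->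
  rr - 2 * p * gamma * s + k * p * Z + p ^+ 2 * cB * gamma ^+ 2 * F2
    + 4 * k * ((1 - p) * Y + p * U) <= (1 - rho) * (rr + 4 * k * Y).
Proof.
move=> k0 p0 g0 B0 mu0 r0 rY HD FD sD Dr ZY UE gE rho1 rho2.
have p0' := ltW p0.
have g20 : 0 <= gamma ^+ 2 by exact: sqr_ge0.
have p20 : 0 <= p ^+ 2 by exact: sqr_ge0.
have T1 := ler_wpM2l (mulr_ge0 k0 p0') ZY.
have T2 := ler_wpM2l (mulr_ge0 (mulr_ge0 p20 B0) g20) FD.
have T3 := ler_wpM2l (mulr_ge0 (mulr_ge0 k0 p0') g20) HD.
have T5 := ler_wpM2l (mulr_ge0 p0' g0) sD.
have T6 : k * p * gamma * (mu * rr) <= k * p * gamma * s.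
  by apply: ler_wpM2l; [rewrite !mulr_ge0 | lra].
have T4 : p * D * (gamma ^+ 2 * (p * cB * Lf + 6 * k * L)) = p * D * gamma.
  by rewrite gE.
have T7 : rho * (rr * (1 + 4 * k)) <= p * gamma * mu * (rr * (1 + 4 * k)).
  by apply: ler_wpM2r => //; apply: mulr_ge0 => //; lra.
have T8 : rho * (k * (Y - rr)) <= p / 2 * (k * (Y - rr)).
  by apply: ler_wpM2r => //; apply: mulr_ge0 => //; lra.
have T9 : 0 <= k * p * gamma * (mu * rr) by rewrite !mulr_ge0.
rewrite UE.
lra.
Qed.

Section Step.
Context {R : realType} {d n : nat} (n_gt0 : (0 < n)%N).
Context (f : 'I_n -> 'rV[R]_d -> R) (mu Lf L : R) (xstar : 'rV[R]_d).
Context (P : {set 'I_n} -> R) (cA cB p gamma rho : R).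
Hypotheses (mu_ge0 : 0 <= mu) (cf : strongly_convex mu (average f)).
Hypotheses (sf : smooth Lf (average f)).
Hypotheses (fmin : forall x, average f xstar <= average f x).
Hypotheses (cfi : forall i, strongly_convex 0 (f i)).
Hypotheses (sfi : forall i, smooth L (f i)).
Hypotheses (P_distr : is_distribution P).
Hypotheses (p_gt0 : 0 < p) (pE : forall i, incl_prob P i = p).
Hypotheses (cA_ge0 : 0 <= cA) (cB_ge0 : 0 <= cB) (AB : AB_inequality d P cA cB).
Hypothesis gamma_ge0 : 0 <= gamma.
Hypothesis gammaE : p * gamma ^+ 2 * (cB * Lf + 6 * cA * L / n%:R) = gamma.
Hypotheses (rho_le1 : rho <= p * gamma * mu) (rho_le2 : rho <= p / 2).

(** The coefficient of [miso_W0] equals [4 A tau / n^3] because [tau = n p]. *)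
Definition lyapunov (phi : 'I_n -> 'rV[R]_d) : R :=
  enorm (miso_point f gamma phi - xstar) ^+ 2
  + 4 * cA * p / n%:R ^+ 2 * miso_W0 f gamma phi xstar.

Definition miso_step (phi : 'I_n -> 'rV[R]_d) (A : {set 'I_n}) :
    'I_n -> 'rV[R]_d :=
  fun i => if i \in A then miso_point f gamma phi else phi i.

Let n0 : (n%:R : R) != 0.
Proof. by rewrite pnatr_eq0 -lt0n. Qed.

Let gradE x : gradient (average f) x = n%:R^-1 *: \sum_(i < n) gradient (f i) x.
Proof. by apply: gradient_average => i; have [_] := sfi i. Qed.

Let sum_grad x : \sum_(i < n) gradient (f i) x = n%:R *: gradient (average f) x.
Proof. by rewrite gradE scalerA divff // scale1r. Qed.

Let grad_star : gradient (average f) xstar = 0.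
Proof. exact: smooth_minimizer_gradient sf fmin. Qed.

(** Deviation of the table entry [phi i - gamma f_i'(phi i)] from its value at
    the fixed point; [miso_W0] is the sum of the squared norms. *)
Let offset (phi : 'I_n -> 'rV[R]_d) i :=
  phi i - xstar - gamma *: gradient (f i) (phi i)
  + gamma *: gradient (f i) xstar.

(** The [f_i'(xstar)] average to [f'(xstar) = 0], so subtracting them does not
    move the mean. *)
Lemma miso_point_offset phi :
  miso_point f gamma phi - xstar = n%:R^-1 *: \sum_(i < n) offset phi i.
Proof.
rewrite /offset !big_split /= !sumrN sumr_const card_ord -!scaler_sumr.
rewrite (sum_grad xstar) grad_star !scaler0 addr0 !scalerDr !scalerN.
rewrite -[xstar *+ n]scaler_nat.
by rewrite !scalerA mulVf // scale1r /miso_point addrAC [gamma / _]mulrC.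
Qed.

(** In terms of offsets, one step refreshes the entries in the drawn set, from
    [w i] to [u i = r - gamma (f_i'(x) - f_i'(xstar))]; hence [mean_replace_sqr]
    and [sum_replace] express the averaged potential through the quantities of
    [lyapunov_drift]. *)
Lemma lyapunov_step (phi : 'I_n -> 'rV[R]_d) :
  \sum_(A : {set 'I_n}) P A * lyapunov (miso_step phi A)
    <= (1 - rho) * lyapunov phi.
Proof.
set x := miso_point f gamma phi.
pose r := x - xstar; pose g i := gradient (f i) x - gradient (f i) xstar.
pose u i := r - gamma *: g i.
pose w := offset phi.
have rE : r = n%:R^-1 *: \sum_(i < n) w i by exact: miso_point_offset.
have stepE A i : offset (miso_step phi A) i = if i \in A then u i else w i.
  rewrite /offset /miso_step; case: ifP => // _.
  by rewrite /u /r /g scalerBr opprB addrA addrAC.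
have sum_g : \sum_(i < n) g i = n%:R *: gradient (average f) x.
  by rewrite sumrB !sum_grad grad_star scaler0 subr0.
have sum_uw : \sum_(i < n) (u i - w i) = - ((gamma * n%:R) *: gradient (average f) x).
  have -> : \sum_(i < n) (u i - w i)
      = \sum_(i < n) r - \sum_(i < n) w i - gamma *: \sum_(i < n) g i.
    by rewrite scaler_sumr -!sumrB; apply: eq_bigr => i _; rewrite addrAC.
  rewrite sum_g scalerA sumr_const card_ord.
  have -> : \sum_(i < n) w i = n%:R *: r by rewrite rE scalerA divff // scale1r.
  by rewrite -[r *+ n]scaler_nat subrr add0r.
pose D := average f x - average f xstar.
pose s := dot (gradient (average f) x) r.
pose F2 := dot (gradient (average f) x) (gradient (average f) x).
pose rr := dot r r.
pose Y := n%:R^-1 * \sum_(i < n) dot (w i) (w i).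
pose H := n%:R^-1 * \sum_(i < n) dot (g i) (g i).
pose Z := n%:R^-1 * \sum_(i < n) dot (u i - w i) (u i - w i).
pose U := n%:R^-1 * \sum_(i < n) dot (u i) (u i).
pose k := cA * p / n%:R.
have n_pos : 0 < n%:R^-1 :> R by rewrite invr_gt0 ltr0n.
have dev : n%:R^-1 * \sum_(i < n) dot (w i - r) (w i - r) = Y - rr.
  by rewrite (sum_mean_dev w r n_gt0 rE) mulrBr mulrA mulVf // mul1r.
have HD : H <= 2 * L * D.
  have -> : D = n%:R^-1 * \sum_(i < n)
                 (f i x - f i xstar - dot (gradient (f i) xstar) (x - xstar)).
    rewrite !sumrB -dot_suml sum_grad grad_star scaler0 dot0l subr0.
    by rewrite mulrBr.
  rewrite [leRHS]mulrCA; apply: ler_wpM2l; first exact: ltW.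
  by rewrite mulr_sumr; apply: ler_sum => i _; exact: smooth_convex_cocoercive.
have xrE : x - r = xstar by rewrite /r opprB addrC subrK.
have sD : D + mu / 2 * rr <= s.
  have := strongly_convex_first_order mu Lf (average f) x (- r) cf sf.
  rewrite xrE !(dotNl, dotNr) opprK -/s -/rr /D; lra.
have Dr : mu / 2 * rr <= D.
  have := strongly_convex_first_order mu Lf (average f) xstar r cf sf.
  rewrite -[X in X + r]xrE subrK grad_star dot0l -/rr /D; lra.
have FD : F2 <= 2 * Lf * D by exact: smooth_minimizer_sqr_gradient.
have ZE : Z <= 2 * (Y - rr) + 2 * gamma ^+ 2 * H.
  have -> : 2 * (Y - rr) + 2 * gamma ^+ 2 * H
      = n%:R^-1 * \sum_(i < n) (2 * dot (w i - r) (w i - r)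
                               + 2 * dot (gamma *: g i) (gamma *: g i)).
    rewrite -dev big_split /= -!mulr_sumr.
    have -> : \sum_(i < n) dot (gamma *: g i) (gamma *: g i)
              = gamma ^+ 2 * \sum_(i < n) dot (g i) (g i).
      by rewrite mulr_sumr; apply: eq_bigr => i _; rewrite dotZl dotZr mulrA expr2.
    by rewrite /H; ring.
  apply: ler_wpM2l; first exact: ltW.
  by apply: ler_sum => i _; exact: dot_sub2_le.
have UE : U = rr - 2 * gamma * s + gamma ^+ 2 * H.
  have -> : s = n%:R^-1 * \sum_(i < n) dot (g i) r.
    by rewrite -dot_suml sum_g dotZl mulKf.
  have -> : rr = n%:R^-1 * \sum_(i < n) dot r r.
    by rewrite sumr_const card_ord -[dot r r *+ n]mulr_natl mulKf.
  rewrite /U /H mulrCA [_ ^+ 2 * _]mulrCA -mulrN -!mulrDr; congr (_ * _).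
  rewrite !mulr_sumr -sumrN -!big_split; apply: eq_bigr => i _ /=.
  by rewrite dot_subZ; ring.
have rY : rr <= Y.
  rewrite -subr_ge0 -dev; apply: mulr_ge0; first exact: ltW.
  by apply: sumr_ge0 => i _; exact: dot_ge0.
have k0 : 0 <= k by rewrite /k !mulr_ge0 // ltW.
have gE : gamma ^+ 2 * (p * cB * Lf + 6 * k * L) = gamma.
  by rewrite -[RHS]gammaE /k; ring.
have drift := lyapunov_drift rr Y H Z U D s F2 k p gamma cB Lf L mu rho k0 p_gt0
  gamma_ge0 cB_ge0 mu_ge0 (dot_ge0 r) rY HD FD sD Dr ZE UE gE rho_le1 rho_le2.
have mean_part : \sum_(A : {set 'I_n}) P A *
    enorm (miso_point f gamma (miso_step phi A) - xstar) ^+ 2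
    <= rr - 2 * p * gamma * s + k * p * Z + p ^+ 2 * cB * gamma ^+ 2 * F2.
  under eq_bigr do rewrite miso_point_offset.
  under eq_bigr do under eq_bigr do rewrite stepE.
  apply: le_trans (mean_replace_sqr P P_distr cA cB p p_gt0 pE AB u w r rE) _.
  rewrite sum_uw !enorm_sqr !(dotNl, dotNr, dotZl, dotZr) -/rr -/s -/F2.
  under eq_bigr do rewrite enorm_sqr.
  have -> : \sum_(i < n) dot (u i - w i) (u i - w i) = n%:R * Z by rewrite /Z (mulVKf n0).
  have alg (a b c e : R) : a + 2 * (p / n%:R) * - (gamma * n%:R * b)
      + (p / n%:R) ^+ 2 * (cA * (n%:R * e) + cB * - (gamma * n%:R * - (gamma * n%:R * c)))
    = a - 2 * p * gamma * b + k * p * e + p ^+ 2 * cB * gamma ^+ 2 * c.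
    by rewrite /k; field.
  by rewrite alg.
have W_part : \sum_(A : {set 'I_n}) P A * miso_W0 f gamma (miso_step phi A) xstar
    = n%:R * ((1 - p) * Y + p * U).
  rewrite /miso_W0.
  transitivity (\sum_(A : {set 'I_n}) P A *
     (\sum_(i < n) if i \in A then dot (u i) (u i) else dot (w i) (w i))).
    apply: eq_bigr => A _; congr (_ * _); apply: eq_bigr => i _.
    by rewrite -/(offset _ _) stepE enorm_sqr; case: ifP.
  rewrite (sum_replace P P_distr) /Y /U [RHS]mulrDr.
  rewrite [_ * (_ * (_^-1 * _))]mulrCA (mulrCA _ p).
  rewrite !(mulVKf n0) !mulr_sumr -big_split.
  by apply: eq_bigr => i _; rewrite pE.
rewrite {1}/lyapunov; under eq_bigr do rewrite mulrDr [_ * (_ * _)]mulrCA.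
rewrite big_split -mulr_sumr W_part /=.
have W0E : miso_W0 f gamma phi xstar = n%:R * Y.
  by rewrite /Y (mulVKf n0); apply: eq_bigr => i _; rewrite enorm_sqr.
have VE : lyapunov phi = rr + 4 * cA * p / n%:R ^+ 2 * (n%:R * Y).
  by rewrite -W0E /rr -enorm_sqr.
rewrite VE.
have e z : 4 * cA * p / n%:R ^+ 2 * (n%:R * z) = 4 * k * z by rewrite /k; field.
rewrite !e; apply: le_trans drift.
by rewrite lerD2r.
Qed.

End Step.

(** * Expectations of functions of independent draws *)

Lemma ge0_expectation_finite {dO : measure_display} {Omega : measurableType dO}
    {R : realType} (Pr : probability Omega R) (F : finType) (X : Omega -> F)
    (g : F -> R) :
  (forall t, measurable (X @^-1` [set t])) -> (forall t, 0 <= g t) ->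
  ('E_Pr[fun w => g (X w)] = \sum_(t : F) (g t)%:E * Pr (X @^-1` [set t]))%E.
Proof.
move=> mX g0; rewrite unlock.
transitivity (\int[Pr]_w (\sum_(t : F) (g t * \1_(X @^-1` [set t]) w)%:E))%E.
  apply: eq_integral => w _; rewrite sumEFin (bigD1 (X w)) //= big1 => [|t tX].
    by rewrite indicE mem_set // mulr1 addr0.
  rewrite indicE memNset ?mulr0 //= => Xt.
  by rewrite Xt eqxx in tX.
rewrite ge0_integral_sum //=; first last.
- by move=> t w _; rewrite lee_fin mulr_ge0 // indicE ler0n.
- move=> t; apply/measurable_realfun.measurable_EFinP.
  apply: measurable_realfun.measurable_funM => //; exact: measurable_realfun.measurable_indic.
apply: eq_bigr => t _.
rewrite (integralZl_indic _ (fun=> X @^-1` [set t])) //; last first.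
  by rewrite ltNge g0.
by rewrite integral_indic // setIT.
Qed.

Fixpoint run {X E : Type} (step : X -> E -> X) (x0 : X) (s : nat -> E) (k : nat) : X :=
  if k is k'.+1 then step (run step x0 s k') (s k') else x0.

Lemma eq_run {X E : Type} (step : X -> E -> X) x0 (s s' : nat -> E) k :
  (forall j, (j < k)%N -> s j = s' j) -> run step x0 s k = run step x0 s' k.
Proof.
elim: k => //= k IH ss'; rewrite IH ?ss' // => j jk; exact/ss'/ltnW.
Qed.

Section IndependentDraws.
Context {R : realType} {n : nat} {dO : measure_display} {Omega : measurableType dO}.
Context (Pr : probability Omega R) (P : {set 'I_n} -> R).
Context (S : nat -> Omega -> {set 'I_n}).
Hypotheses (P_distr : is_distribution P) (indep : independent_draws Pr P S).

Definition past (k : nat) (w : Omega) : {ffun 'I_k -> {set 'I_n}} :=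
  [ffun j : 'I_k => S j w].

Definition past_prob k (h : {ffun 'I_k -> {set 'I_n}}) : R :=
  fine (Pr (past k @^-1` [set h])).

Lemma measurable_past k h : measurable (past k @^-1` [set h]).
Proof.
have [mS _ _] := indep.
have -> : past k @^-1` [set h] = \bigcap_(j in [set: 'I_k]) (S j @^-1` [set h j]).
  apply/seteqP; split => w /=.
    by move=> <- j _; rewrite /= ffunE.
  by move=> hw; apply/ffunP => j; rewrite ffunE; exact: hw.
by apply: fin_bigcap_measurable => // j _; exact: mS.
Qed.

Lemma past_probE k h : Pr (past k @^-1` [set h]) = (past_prob k h)%:E.
Proof. by rewrite fineK // fin_num_measure //; exact: measurable_past. Qed.

(** The pair of the past and the current draw is a random variable with
    finitely many values, whose law factors by independence. *)
Lemma expectation_past_draw k (g : {ffun 'I_k -> {set 'I_n}} -> {set 'I_n} -> R) :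
  (forall h A, 0 <= g h A) ->
  'E_Pr[fun w => g (past k w) (S k w)]%E
    = (\sum_h past_prob k h * (\sum_A P A * g h A))%:E.
Proof.
move=> g0; have [mS lawS indS] := indep.
pose X w := (past k w, S k w).
have XE h A : X @^-1` [set (h, A)] = past k @^-1` [set h] `&` S k @^-1` [set A].
  by apply/seteqP; split => w /=; [case=> <- <- | rewrite /X => -[-> ->]].
rewrite (@ge0_expectation_finite _ _ _ Pr _ X (fun t => g t.1 t.2)) //; last first.
  by move=> [h A]; rewrite XE; apply: measurableI; [exact: measurable_past | exact: mS].
have termE t : ((g t.1 t.2)%:E * Pr (X @^-1` [set t]))%E
    = (g t.1 t.2 * (past_prob k t.1 * P t.2))%:E.
  by case: t => h A; rewrite XE (indS k [set h] [set A]) lawS past_probE -!EFinM.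
under eq_bigr do rewrite termE.
rewrite sumEFin; congr (_%:E).
rewrite -(pair_bigA _ (fun h A => g h A * (past_prob k h * P A))) /=.
apply: eq_bigr => h _; rewrite mulr_sumr; apply: eq_bigr => A _.
by rewrite mulrCA [g h A * _]mulrC.
Qed.

Lemma expectation_past k (g : {ffun 'I_k -> {set 'I_n}} -> R) :
  (forall h, 0 <= g h) ->
  'E_Pr[fun w => g (past k w)]%E = (\sum_h past_prob k h * g h)%:E.
Proof.
move=> g0; rewrite (@expectation_past_draw k (fun h _ => g h)) //.
congr (_%:E); apply: eq_bigr => h _.
by rewrite -mulr_suml P_distr.2 mul1r.
Qed.

Section Run.
Context {X : Type} (step : X -> {set 'I_n} -> X) (x0 : X).

(** The state after [k] draws is a function of these draws alone: a run reads
    only the first [k] entries of its sequence, so any padding will do. *)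
Lemma run_past k : exists r : {ffun 'I_k -> {set 'I_n}} -> X,
  forall w, run step x0 (S ^~ w) k = r (past k w).
Proof.
pose ext (h : {ffun 'I_k -> {set 'I_n}}) (j : nat) : {set 'I_n} :=
  oapp h finset.set0 (insub j).
exists (fun h => run step x0 (ext h) k) => w.
by apply: eq_run => i ik; rewrite /ext insubT /= ffunE.
Qed.

Lemma expectation_run_mono (Q V : X -> R) k :
  (forall x, 0 <= Q x) -> (forall x, Q x <= V x) ->
  ('E_Pr[fun w => Q (run step x0 (S ^~ w) k)]
   <= 'E_Pr[fun w => V (run step x0 (S ^~ w) k)])%E.
Proof.
move=> Q0 QV; have [r rE] := run_past k.
have funE (F : X -> R) :
    (fun w => F (run step x0 (S ^~ w) k)) = (fun w => (F \o r) (past k w)).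
  by apply/funext => w /=; rewrite rE.
rewrite !funE !expectation_past => [|h|h] /=; last 2 first.
- exact: le_trans (Q0 _) (QV _).
- exact: Q0.
rewrite lee_fin; apply: ler_sum => h _.
by apply: ler_wpM2l; [exact/fine_ge0 | exact: QV].
Qed.

(** A potential that contracts on average under every single draw, from every
    state, contracts geometrically in expectation along the run: condition on
    the past and use that the next draw is independent of it. *)
Lemma expectation_run_le (V : X -> R) (c : R) k :
  (forall x, 0 <= V x) -> 0 <= c ->
  (forall x, \sum_(A : {set 'I_n}) P A * V (step x A) <= c * V x) ->
  ('E_Pr[fun w => V (run step x0 (S ^~ w) k)] <= (c ^+ k * V x0)%:E)%E.
Proof.
move=> V0 c0 Vstep; elim: k => [|k IH].
  by rewrite expr0 mul1r /= expectation_cst.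
have [r rE] := run_past k.
have EVk : 'E_Pr[fun w => V (run step x0 (S ^~ w) k)]%E
    = (\sum_h past_prob k h * V (r h))%:E.
  rewrite -expectation_past => [|h]; last exact: V0.
  by congr (expectation _ _); apply/funext => w; rewrite rE.
have -> : (fun w => V (run step x0 (S ^~ w) k.+1))
    = (fun w => V (step (r (past k w)) (S k w))).
  by apply/funext => w /=; rewrite rE.
rewrite (@expectation_past_draw k (fun h A => V (step (r h) A))) //.
move: IH; rewrite EVk !lee_fin => IH.
rewrite exprS -mulrA; apply: le_trans (ler_wpM2l c0 IH).
rewrite mulr_sumr; apply: ler_sum => h _; rewrite mulrCA.
by apply: ler_wpM2l; [exact/fine_ge0 | exact: Vstep].
Qed.

End Run.

End IndependentDraws.

(** * The convergence rate *)

Lemma miso_phiE {R : realType} {d n : nat} (f : 'I_n -> 'rV[R]_d -> R) (gamma : R)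
    phi0 s k :
  miso_phi f gamma phi0 s k = run (miso_step f gamma) phi0 s k.
Proof. by elim: k => //= k ->. Qed.

Theorem theorem5p3 (R : realType) (d n : nat) (n_gt0 : (0 < n)%N)
    (f : 'I_n -> 'rV[R]_d -> R) (mu Lf L : R) (xstar : 'rV[R]_d)
    (P : {set 'I_n} -> R) (cA cB : R) (phi0 : 'I_n -> 'rV[R]_d)
    (dO : measure_display) (Omega : measurableType dO)
    (Pr : probability Omega R) (S : nat -> Omega -> {set 'I_n}) :
  0 < mu ->
  strongly_convex mu (average f) ->
  smooth Lf (average f) ->
  (forall x, average f xstar <= average f x) ->
  (forall i, convex_function setT (f i)) ->
  (forall i, smooth L (f i)) ->
  is_distribution P -> proper_sampling P -> uniform_sampling P ->
  0 <= cA -> 0 <= cB ->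
  AB_inequality d P cA cB ->
  independent_draws Pr P S ->
  let tau := minibatch_size P in
  let calL := cB * Lf + 6 * cA * L / n%:R in
  let gamma := n%:R / (tau * calL) in
  let rate12 := Num.min (tau / (2 * n%:R)) (mu / (2 * calL)) in
  let rate :=
    if cA == 0 then rate12
    else Num.min rate12 (mu * n%:R ^+ 2 / (8 * cA * tau * calL)) in
  let x w := miso_x f gamma phi0 (fun j => S j w) in
  let x0 := miso_point f gamma phi0 in
  forall k : nat,
    ('E_Pr[fun w => (enorm (x w k - xstar) ^+ 2)%R]
     <= ((1 - rate) ^+ k
         * (enorm (x0 - xstar) ^+ 2
            + 4 * cA * tau / n%:R ^+ 3 * miso_W0 f gamma phi0 xstar))%:E)%E.
Proof.
move=> mu_gt0 cf sf fmin cfi sfi P_distr P_proper P_unif cA_ge0 cB_ge0 AB S_indep.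
move=> tau calL gamma rate12 rate x x0 k.
pose i0 := Ordinal n_gt0; pose p := incl_prob P i0.
have pE i : incl_prob P i = p by exact: P_unif.
have p_gt0 : 0 < p by exact: P_proper.
have n_gt0R : 0 < n%:R :> R by rewrite ltr0n.
have n_neq0 : n%:R != 0 :> R by rewrite gt_eqF.
have [Lf_ge0 _ _] := sf.
have [L_ge0 _ _] := sfi i0.
have tauE : tau = n%:R * p.
  rewrite /tau minibatch_sizeE; under eq_bigr do rewrite pE.
  by rewrite sumr_const card_ord mulr_natl.
have calL_ge0 : 0 <= calL.
  by rewrite /calL addr_ge0 // ?divr_ge0 // ?mulr_ge0 // ltW.
have tau_ge0 : 0 <= tau by rewrite tauE mulr_ge0 // ltW.
have gamma_ge0 : 0 <= gamma by rewrite divr_ge0 ?mulr_ge0 // ltW.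
(* holds for calL = 0 too, where both sides are 0 *)
have p_gamma : p * gamma = calL^-1.
  by rewrite /gamma tauE !invfM !mulrA mulfK // divff ?mul1r ?gt_eqF.
have gammaE : p * gamma ^+ 2 * calL = gamma.
  rewrite expr2 mulrA p_gamma mulrAC.
  have [calL0|calL_neq0] := eqVneq calL 0; last by rewrite mulVf // mul1r.
  by rewrite /gamma calL0 !(mulr0, invr0, mul0r).
have rate_le12 : rate <= rate12.
  by rewrite /rate; case: ifP => _ //; rewrite ge_min lexx.
have rate_le_mu : rate <= p * gamma * mu.
  apply: le_trans rate_le12 _; rewrite /rate12 ge_min p_gamma; apply/orP; right.
  rewrite [leRHS]mulrC; apply: ler_wpM2l; first exact: ltW.
  by rewrite invfM ler_piMl ?invr_ge0 // invf_le1 ?ler1n.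
have rate_le_p : rate <= p / 2.
  apply: le_trans rate_le12 _; rewrite /rate12 ge_min; apply/orP; left.
  by rewrite tauE [2 * _]mulrC -mulf_div divff // mul1r.
have contr_ge0 : 0 <= 1 - rate.
  have := incl_prob_le1 P i0 P_distr; rewrite -/p; lra.
pose V := lyapunov f xstar cA p gamma.
have W_ge0 phi : 0 <= miso_W0 f gamma phi xstar.
  by apply: sumr_ge0 => i _; exact: sqr_ge0.
have Q_le_V phi : enorm (miso_point f gamma phi - xstar) ^+ 2 <= V phi.
  by rewrite lerDl mulr_ge0 // divr_ge0 ?exprn_ge0 ?mulr_ge0 // ltW.
have V_ge0 phi : 0 <= V phi by apply: le_trans (Q_le_V phi); exact: sqr_ge0.
have V_step phi : \sum_(A : {set 'I_n}) P A * V (miso_step f gamma phi A)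
    <= (1 - rate) * V phi.
  apply: (@lyapunov_step _ _ _ n_gt0 f mu Lf L xstar P cA cB) => //.
    exact: ltW.
  by move=> i; exact: convex_function_strongly_convex0.
have -> : enorm (x0 - xstar) ^+ 2
      + 4 * cA * tau / n%:R ^+ 3 * miso_W0 f gamma phi0 xstar
    = V phi0.
  rewrite /V /lyapunov; congr (_ + _ * _).
  by rewrite tauE; field.
apply: le_trans (expectation_run_le Pr P S P_distr S_indep
  _ phi0 V (1 - rate) k V_ge0 contr_ge0 V_step).
have -> : (fun w => enorm (x w k - xstar) ^+ 2)
  = (fun w => enorm (miso_point f gamma
      (run (miso_step f gamma) phi0 (S ^~ w) k) - xstar) ^+ 2).
  by apply/funext => w; rewrite /x /miso_x miso_phiE.
apply: (expectation_run_mono Pr P S P_distr S_indep (miso_step f gamma) phi0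
  (fun phi => enorm (miso_point f gamma phi - xstar) ^+ 2)) => // phi.
exact: sqr_ge0.
Qed.
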